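(* Let $d \geq 1$ and let $G=(V,E)$ be a $d$-rigid graph with $|V| \geq d+1$. If $H$ is a spanning subgraph of $G$ that is $d$-rigid, then $c_d(G)$ divides $c_d(H)$.
   Context: All graphs are finite and simple. On $\mathbb{C}^d$ use the (non-Hermitian) quadratic form $\|x\|^2=\sum_{i=1}^d x_i^2$. A framework $(G,p)$ is a graph $G=(V,E)$ with a map $p:V\to\mathbb{C}^d$; it is generic if its $d|V|$ coordinates are algebraically independent over $\mathbb{Q}$. Two realisations $p,q$ are equivalent if $\|p(v)-p(w)\|^2=\|q(v)-q(w)\|^2$ for every edge $vw\in E$, and congruent if $q=Ap+b$ for some $b\in\mathbb{C}^d$ and $A$ a complex $d\times d$ matrix with $A^TA=AA^T=I$. A framework is rigid if every continuous path of equivalent realisations starting at $p$ stays congruent to $p$; $G$ is $d$-rigid if some generic framework of $G$ in $\mathbb{R}^d$ or $\mathbb{C}^d$ is rigid. For a $d$-rigid graph $G$ with $|V|\ge d+1$, the (complex) $d$-realisation number $c_d(G)$ is the number of congruence classes of realisations $q:V\to\mathbb{C}^d$ equivalent to $p$, for generic $p$ (this number is the same for all generic $p$); if $|V|\le d$, $c_d(G)=1$ when $G$ is complete and $\infty$ otherwise. *)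

(* Defs.v *)
From HB Require Import structures.
From mathcomp Require Import all_boot all_order all_algebra.
From mathcomp Require Import mpoly. (* must come before analysis (notation levels) *)
From mathcomp Require Import all_classical all_reals all_analysis.
From mathcomp Require Import complex.
Set Implicit Arguments. Unset Strict Implicit. Unset Printing Implicit Defensive.
Import Order.TTheory GRing.Theory Num.Theory.
Import numFieldTopology.Exports numFieldNormedType.Exports.
Local Open Scope ring_scope.
Local Open Scope complex_scope.
Local Open Scope classical_set_scope.

(* Throughout, the complex numbers are R[i] = complex R for a real type R
   (e.g. the classical reals).  A graph on the finite vertex type V is a
   symmetric irreflexive boolean relation E : rel V (edges vw with E v w). *)

(* Equip C = R[i] with its usual (modulus) metric topology, i.e. the one
   MathComp-Analysis gives to every numFieldType. *)
HB.instance Definition _ (R : realType) :=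
  PseudoPointedMetric.copy R[i] (R[i] : numClosedFieldType)^o.

Definition simple_graph (V : finType) (E : rel V) : Prop :=
  irreflexive E /\ ssrbool.symmetric E.

Definition realisation (R : realType) (V : finType) (d : nat) :=
  V -> 'rV[R[i]]_d.

Definition sqnorm (R : realType) (d : nat) (x : 'rV[R[i]]_d) : R[i] :=
  \sum_(k < d) (x 0 k) ^+ 2.

Definition equivalent (R : realType) (V : finType) (d : nat) (E : rel V)
    (p q : realisation R V d) : Prop :=
  forall v w, E v w -> sqnorm (p v - p w) = sqnorm (q v - q w).

Definition congruent (R : realType) (V : finType) (d : nat)
    (p q : realisation R V d) : Prop :=
  exists (A : 'M[R[i]]_d) (b : 'rV[R[i]]_d),
    A^T *m A = 1%:M /\ A *m A^T = 1%:M /\ forall v, q v = p v *m A^T + b.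

Definition coords (R : realType) (V : finType) (d : nat) (p : realisation R V d)
    : 'I_#|{: V * 'I_d}| -> R[i] :=
  fun k => let vk := enum_val k in p vk.1 0 vk.2.

Definition generic (R : realType) (V : finType) (d : nat) (p : realisation R V d)
    : Prop :=
  forall P : mpoly.mpoly #|{: V * 'I_d}| rat,
    P != 0 -> mpoly.mmap (@ratr R[i]) (coords p) P != 0.

(* (G,p) is rigid: every continuous path t in [0,1] |-> gamma t of realisations
   equivalent to p with gamma 0 = p stays congruent to p.  Continuity of the
   path into C^(d|V|) is continuity of each coordinate. *)
Definition rigid (R : realType) (V : finType) (d : nat) (E : rel V)
    (p : realisation R V d) : Prop :=
  forall gamma : R -> realisation R V d,
    gamma 0 = p ->
    (forall v k, {within `[0, 1]%classic, continuous (fun t => gamma t v 0 k)}) ->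
    (forall t, 0 <= t <= 1 -> equivalent E p (gamma t)) ->
    forall t, 0 <= t <= 1 -> congruent p (gamma t).

Definition d_rigid (R : realType) (V : finType) (d : nat) (E : rel V) : Prop :=
  exists p : realisation R V d, generic p /\ rigid E p.

Definition num_congruence_classes (R : realType) (V : finType) (d : nat)
    (E : rel V) (p : realisation R V d) (n : nat) : Prop :=
  exists r : 'I_n -> realisation R V d,
    [/\ forall j, equivalent E p (r j),
        forall j k, congruent (r j) (r k) -> j = k
      & forall q, equivalent E p q -> exists j, congruent (r j) q].

Definition realisation_number (R : realType) (V : finType) (d : nat)
    (E : rel V) (n : nat) : Prop :=
  forall p : realisation R V d, generic p -> num_congruence_classes E p n.

(* Main.v *)
(** Two realisations with coordinates "of the same type over Q" are exchanged by
    a back-and-forth argument: a partial isomorphism between countable subrings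
    of C extends to any further element of C.  Hence the number of congruence
    classes of realisations equivalent to a generic p is independent of p.

    If p is rigid, each squared distance of p is algebraic over the field
    generated by the edge lengths: otherwise it could be moved while the edge
    lengths stay fixed, the remaining coordinates following continuously as roots
    of polynomials.  For generic p the algebraic relations are identities between
    polynomials, so a realisation q equivalent to p satisfies them too.  This
    leaves finitely many choices for the distances of q, and shows that p and q
    have distances of the same type over Q, so that q is congruent to a generic
    realisation.

    Finally let H be a spanning subgraph of G.  The c(H) congruence classes of
    realisations H-equivalent to p are partitioned by G-equivalence, and each part
    consists of the classes of realisations G-equivalent to a generic
    realisation, so it has c(G) elements. *)
Require Import Defs.
From HB Require Import structures.
From mathcomp Require Import all_boot all_order all_algebra.
From mathcomp Require Import mpoly.
From mathcomp Require Import all_classical all_reals all_analysis.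
From mathcomp Require Import complex.
From mathcomp Require Import ring lra.
Set Implicit Arguments. Unset Strict Implicit. Unset Printing Implicit Defensive.
Import Order.TTheory GRing.Theory Num.Theory.
Import Normc.
Local Open Scope ring_scope.
Local Open Scope complex_scope.

(** * Adjoining an element *)

Section Adjunction.
Variables (G : comNzRingType) (K : fieldType).
Implicit Types (a b : {rmorphism G -> K}) (P mu : {poly G}) (x y : K).

Definition adjoin a x : {rmorphism {poly G} -> K} := horner_eval x \o map_poly a.

Lemma adjoinE a x P : adjoin a x P = (map_poly a P).[x].
Proof. by []. Qed.

Lemma adjoinC a x g : adjoin a x g%:P = a g.
Proof. by rewrite adjoinE map_polyC hornerC. Qed.

Lemma adjoinX a x : adjoin a x 'X = x.
Proof. by rewrite adjoinE map_polyX hornerX. Qed.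

Lemma adjoin_MXaddC a x P g :
  adjoin a x (P * 'X + g%:P) = adjoin a x P * x + a g.
Proof. by rewrite !adjoinE rmorphD rmorphM /= map_polyX map_polyC hornerMXaddC. Qed.

(** As [a] may have a kernel, it is the image of [P] that has to be nonzero. *)
Definition algebraic_over a x := exists2 P, map_poly a P != 0 & adjoin a x P = 0.

(** The image of [mu] is a non-monic minimal polynomial of [x] over the field generated by the image
    of [a]. The coefficients are kept in [G] so that a second morphism can be applied to them. *)
Definition minimal_relation a x mu :=
  [/\ a (lead_coef mu) != 0, adjoin a x mu = 0
    & forall P, adjoin a x P = 0 -> (size (map_poly a P) < size mu)%N ->
        map_poly a P = 0].

Lemma map_poly_eq0P a P : reflect (forall i, a P`_i = 0) (map_poly a P == 0).
Proof.
apply: (iffP eqP) => [/polyP P0 i|P0]; first by have := P0 i; rewrite coef_map coef0.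
by apply/polyP => i; rewrite coef_map coef0; exact: P0.
Qed.

Lemma exists_minimal_relation a x :
  algebraic_over a x -> exists mu, minimal_relation a x mu.
Proof.
case=> P; have [n] := ubnP (size (map_poly a P)); elim: n P => // n IHn P.
rewrite ltnS => szP P0 Px.
have [[Q [Q0 Qx szQ]]|noQ] := EM (exists Q, [/\ map_poly a Q != 0,
    adjoin a x Q = 0 & (size (map_poly a Q) < size (map_poly a P))%N]).
  exact: (IHn Q (leq_trans szQ szP)).
(* Truncation to the size of the image drops top coefficients killed by [a], so that the leading
   coefficient survives. *)
pose mu := \poly_(i < size (map_poly a P)) P`_i.
have mapmu : map_poly a mu = map_poly a P.
  apply/polyP => i; rewrite !coef_map /= coef_poly.
  case: ltnP => // le_i; rewrite rmorph0.
  by have /esym := nth_default 0 le_i; rewrite coef_map.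
have szmu : size mu = size (map_poly a P).
  apply/eqP; rewrite eqn_leq size_poly -[in X in (_ && X)]mapmu.
  exact: size_poly.
exists mu; split.
- rewrite lead_coefE szmu -[a _]coef_map mapmu -lead_coefE lead_coef_eq0.
  exact: P0.
- by rewrite adjoinE mapmu.
- move=> Q Qx; rewrite szmu => szQ; apply/eqP/negPn/negP => Q0.
  by apply: noQ; exists Q.
Qed.

Lemma size_minimal_relation a x mu : minimal_relation a x mu ->
  size (map_poly a mu) = size mu.
Proof. by case=> lead0 _ _; rewrite size_map_poly_id0. Qed.

Lemma size_minimal_relation_gt1 a x mu : minimal_relation a x mu ->
  (1 < size mu)%N.
Proof.
move=> min_mu; have [lead0 mux _] := min_mu; rewrite ltnNge; apply/negP => le1.
move: mux lead0; rewrite (size1_polyC le1) adjoinC lead_coefC => ->.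
by rewrite eqxx.
Qed.

(* Pseudo-division by mu leaves a remainder which minimality forces to be
   killed by a. *)
Lemma minimal_relation_dvd a x mu P : minimal_relation a x mu ->
  adjoin a x P = 0 ->
  exists k Q, map_poly a (lead_coef mu ^+ k *: P - Q * mu) = 0.
Proof.
move=> [lead0 mux min_mu] Px.
have mu0 : mu != 0 by apply: contraNneq lead0 => ->; rewrite lead_coef0 rmorph0.
have := Pdiv.ComRing.rdivp_eq mu P.
set k := Pdiv.CommonRing.rscalp P mu; set Q := Pdiv.CommonRing.rdivp P mu.
set r := Pdiv.CommonRing.rmodp P mu => divE.
have rE : lead_coef mu ^+ k *: P - Q * mu = r by rewrite divE addrC addKr.
exists k, Q; rewrite rE; apply: min_mu.
  rewrite -rE rmorphB rmorphM mux mulr0 subr0 -mul_polyC rmorphM Px mulr0.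
  by [].
apply: leq_ltn_trans (size_poly _ _) _.
exact: Pdiv.CommonRing.ltn_rmodpN0.
Qed.

(** Pseudo-division gives a power of [lead_coef mu] times [P] as a multiple of [mu] modulo the
    kernel of [a], hence modulo that of [b]; evaluation at [y] then leaves a nonzero factor to
    cancel. *)
Lemma minimal_relation_specialize a b x y mu P :
    (forall g, a g = 0 -> b g = 0) -> minimal_relation a x mu ->
    b (lead_coef mu) != 0 -> adjoin b y mu = 0 ->
  adjoin a x P = 0 -> adjoin b y P = 0.
Proof.
move=> ab min_mu lead0 muy /(minimal_relation_dvd min_mu)[k [Q /eqP/map_poly_eq0P r0]].
have /eqP : adjoin b y (lead_coef mu ^+ k *: P - Q * mu) = 0.
  rewrite adjoinE; suff /eqP -> : map_poly b (lead_coef mu ^+ k *: P - Q * mu) == 0.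
    by rewrite horner0.
  by apply/map_poly_eq0P => i; apply: ab.
rewrite rmorphB rmorphM muy mulr0 subr0 -mul_polyC rmorphM adjoinC.
by rewrite mulf_eq0 rmorphXn expf_eq0 (negPf lead0) andbF => /eqP.
Qed.

(** A minimal relation [nu] of [y] divides [mu] up to a constant, first for [b] and then for [a]
    since the kernels agree. The cofactor is too small to vanish at [x], so [nu] does, and
    specialisation applies from [b] to [a]. *)
Lemma minimal_relation_converse a b x y mu P :
    (forall g, a g = 0 <-> b g = 0) -> minimal_relation a x mu ->
    adjoin b y mu = 0 ->
  adjoin b y P = 0 -> adjoin a x P = 0.
Proof.
move=> ab min_mu muy Py; have [lead0 mux mu_min] := min_mu.
have b_eq0 g : b g != 0 -> a g != 0 by apply: contraNneq => /ab ->.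
have blead0 : b (lead_coef mu) != 0 by apply: contraNneq lead0 => /ab ->.
have [nu min_nu] : exists nu, minimal_relation b y nu.
  apply: exists_minimal_relation; exists mu => //.
  by rewrite -lead_coef_eq0 lead_coef_map_id0 ?rmorph0.
have [leadnu0 nuy _] := min_nu.
suff nux : adjoin a x nu = 0.
  apply: minimal_relation_specialize min_nu _ nux Py; last exact: b_eq0.
  by move=> g /ab.
have [k [Q /eqP/map_poly_eq0P r0]] := minimal_relation_dvd min_nu muy.
have /map_poly_eq0P/eqP : forall i, a (lead_coef nu ^+ k *: mu - Q * nu)`_i = 0.
  by move=> i; apply/ab.
rewrite rmorphB -mul_polyC !rmorphM /= map_polyC /= => /eqP.
rewrite subr_eq0 mul_polyC => /eqP divE.
have c0 : a (lead_coef nu ^+ k) != 0 by rewrite rmorphXn expf_neq0 // b_eq0.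
have sznu : size (map_poly a nu) = size nu by rewrite size_map_poly_id0 ?b_eq0.
have nu_gt1 := size_minimal_relation_gt1 min_nu.
have szmu := size_minimal_relation min_mu.
have mu_gt1 := size_minimal_relation_gt1 min_mu.
have Qnu0 : map_poly a Q * map_poly a nu != 0.
  by rewrite -divE -size_poly_eq0 size_scale // szmu -lt0n ltnW.
have [Q0 nu0] : map_poly a Q != 0 /\ map_poly a nu != 0.
  by apply/andP; rewrite -negb_or -mulf_eq0.
have : (map_poly a Q * map_poly a nu).[x] = 0.
  by rewrite -divE hornerZ -adjoinE mux mulr0.
rewrite hornerM => /eqP; rewrite mulf_eq0 => /orP[/eqP Qx|/eqP //].
have szQ := size_mul Q0 nu0.
case/eqP: Q0; apply: mu_min Qx _; move: szQ; rewrite -divE size_scale // szmu sznu.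
case: (size nu) nu_gt1 => [|[|n]] // _; rewrite !addnS /= => ->.
by rewrite ltnS leq_addr.
Qed.

(** Otherwise the derivative would be a smaller relation, so its image would be zero; but its top
    coefficient is [lead_coef mu] times a positive integer. *)
Lemma minimal_relation_deriv a x mu : [pchar K] =i pred0 ->
  minimal_relation a x mu -> (map_poly a mu)^`().[x] != 0.
Proof.
move=> char0 min_mu; have [lead0 mux mu_min] := min_mu.
have mu_gt1 := size_minimal_relation_gt1 min_mu.
have szmu := size_minimal_relation min_mu.
rewrite deriv_map; apply/negP => /eqP /mu_min der0.
have /polyP/(_ (size mu).-2) : map_poly a mu^`() = 0.
  apply: der0; rewrite -deriv_map -szmu lt_size_deriv // -size_poly_gt0 szmu.
  exact: ltnW.
rewrite coef0 -deriv_map coef_deriv coef_map.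
case: (size mu) mu_gt1 lead0 (lead_coefE mu) => [|[|n]] // _ lead0 /= leadE.
rewrite -leadE -mulr_natr => /eqP; rewrite mulf_eq0 (negPf lead0) /=.
by have /pcharf0P -> := char0.
Qed.
End Adjunction.

(** * Back and forth *)

Lemma algebraic_over_sub (G G' : comNzRingType) (K : fieldType)
    (a : {rmorphism G -> K}) (a' : {rmorphism G' -> K}) x :
  (forall g, exists g', a' g' = a g) -> algebraic_over a x -> algebraic_over a' x.
Proof.
move=> /choice[h hE] [P P0 Px]; pose P' := \poly_(i < size P) h P`_i.
have mapP' : map_poly a' P' = map_poly a P.
  apply/polyP => i; rewrite !coef_map /= coef_poly.
  case: ltnP => [_|le_i]; first exact: hE.
  by rewrite (nth_default 0 le_i) !rmorph0.
by exists P'; [rewrite mapP' | rewrite adjoinE mapP'].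
Qed.

(** * Subrings of the product of a ring with itself *)

Section SubringRelation.
Variable K : nzRingType.
Implicit Types (S : K -> K -> Prop) (x y : K).

Definition subring_rel S :=
  [/\ S 1 1, forall x y x' y', S x y -> S x' y' -> S (x - x') (y - y')
    & forall x y x' y', S x y -> S x' y' -> S (x * x') (y * y')].

Variables (S : K -> K -> Prop) (subS : subring_rel S).

Lemma subring_rel1 : S 1 1. Proof. by case: subS. Qed.

Lemma subring_relB x y x' y' : S x y -> S x' y' -> S (x - x') (y - y').
Proof. by case: subS => _ + _; apply. Qed.

Lemma subring_relM x y x' y' : S x y -> S x' y' -> S (x * x') (y * y').
Proof. by case: subS => _ _; apply. Qed.

Lemma subring_rel0 : S 0 0.
Proof. by have := subring_relB subring_rel1 subring_rel1; rewrite !subrr. Qed.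

Lemma subring_relD x y x' y' : S x y -> S x' y' -> S (x + x') (y + y').
Proof.
move=> Sxy Sxy'; have := subring_relB Sxy (subring_relB subring_rel0 Sxy').
by rewrite !sub0r !opprK.
Qed.

Lemma subring_rel_sum (I : Type) (s : seq I) (f g : I -> K) :
  (forall i, S (f i) (g i)) -> S (\sum_(i <- s) f i) (\sum_(i <- s) g i).
Proof.
by move=> fg; apply: (big_ind2 S) => //; [exact: subring_rel0 | move=> *; exact: subring_relD].
Qed.

Lemma subring_rel_prod (I : Type) (s : seq I) (f g : I -> K) :
  (forall i, S (f i) (g i)) -> S (\prod_(i <- s) f i) (\prod_(i <- s) g i).
Proof.
by move=> fg; apply: (big_ind2 S) => //; [exact: subring_rel1 | move=> *; exact: subring_relM].
Qed.

Lemma subring_relX x y n : S x y -> S (x ^+ n) (y ^+ n).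
Proof.
move=> Sxy; elim: n => [|n IHn]; first exact: subring_rel1.
by rewrite !exprS; apply: subring_relM.
Qed.
End SubringRelation.

Lemma subring_rel_adjoin (G : comNzRingType) (K : fieldType) (S : K -> K -> Prop)
    (a c : {rmorphism G -> K}) x y P :
  subring_rel S -> (forall g, S (a g) (c g)) -> S x y ->
  S (adjoin a x P) (adjoin c y P).
Proof.
move=> subS Sg Sxy; elim/poly_ind: P => [|P g IHP].
  by rewrite !rmorph0; exact: subring_rel0.
by rewrite !adjoin_MXaddC; apply: subring_relD => //; apply: subring_relM.
Qed.

(** * Partial isomorphisms between countable subrings of an algebraically closed field *)

Section BackAndForth.
Variable K : closedFieldType.
Implicit Types (x y u v : K).

(* [pi_dom] need not embed in [K]: what matters is [pi_rel], the graph of an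
   isomorphism between two countable subrings of [K]. *)
Record partial_iso := PartialIso {
  pi_dom : comNzRingType;
  pi_countable : exists f : pi_dom -> nat, injective f;
  pi_left : {rmorphism pi_dom -> K};
  pi_right : {rmorphism pi_dom -> K};
  pi_eq0 : forall g, pi_left g = 0 <-> pi_right g = 0 }.

Implicit Types b : partial_iso.

Definition pi_rel b x y := exists2 g, pi_left b g = x & pi_right b g = y.

Definition pi_le b b' := forall x y, pi_rel b x y -> pi_rel b' x y.

Lemma pi_le_trans b b' b'' : pi_le b b' -> pi_le b' b'' -> pi_le b b''.
Proof. by move=> bb' b'b'' x y /bb'/b'b''. Qed.

Lemma pi_rel_subring b : subring_rel (pi_rel b).
Proof.
split; first by exists 1; rewrite rmorph1.
- by move=> _ _ _ _ [g <- <-] [h <- <-]; exists (g - h); rewrite rmorphB.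
- by move=> _ _ _ _ [g <- <-] [h <- <-]; exists (g * h); rewrite rmorphM.
Qed.

(** Differences of related pairs are related, and related elements vanish together by [pi_eq0]. *)
Lemma pi_rel_eq b x y x' y' : pi_rel b x y -> pi_rel b x' y' -> x = x' <-> y = y'.
Proof.
move=> xy xy'; have [g gx gy] := subring_relB (pi_rel_subring b) xy xy'.
have [l r] := pi_eq0 g; split => /eqP; rewrite -subr_eq0 => /eqP e; apply/eqP;
  rewrite -subr_eq0; apply/eqP.
  by rewrite -gy l // gx.
by rewrite -gx r // gy.
Qed.

Definition pi_swap b : partial_iso :=
  {| pi_countable := pi_countable b;
     pi_left := pi_right b; pi_right := pi_left b;
     pi_eq0 := fun g => iff_sym (pi_eq0 g) |}.

Lemma pi_rel_swap b x y : pi_rel (pi_swap b) x y <-> pi_rel b y x.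
Proof. by split => -[g]; exists g. Qed.

Lemma poly_injective_nat (G : nzRingType) :
  (exists f : G -> nat, injective f) -> exists f : {poly G} -> nat, injective f.
Proof.
case=> f f_inj; exists (fun P : {poly G} => pickle (map f P)) => P Q.
by move=> /(pcan_inj pickleK)/(inj_map f_inj)/val_inj.
Qed.

(** The last clause says that the new graph is generated by the old one and the pair; it keeps
    extensions inside a prescribed relation [S]. *)
Lemma pi_adjoin b x y :
    (forall P, adjoin (pi_left b) x P = 0 <-> adjoin (pi_right b) y P = 0) ->
  exists b', [/\ pi_le b b', pi_rel b' x y
    & forall S, subring_rel S -> S x y -> (forall u v, pi_rel b u v -> S u v) ->
        forall u v, pi_rel b' u v -> S u v].
Proof.
move=> eq0; exists {| pi_countable := poly_injective_nat (pi_countable b);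
  pi_left := adjoin (pi_left b) x; pi_right := adjoin (pi_right b) y;
  pi_eq0 := eq0 |}; split.
- by move=> _ _ [g <- <-]; exists g%:P; exact: adjoinC.
- by exists 'X; exact: adjoinX.
- move=> S subS Sxy Sb _ _ [P <- <-]; apply: subring_rel_adjoin => // g.
  by apply: Sb; exists g.
Qed.

Lemma pi_adjoin_root b x mu y : minimal_relation (pi_left b) x mu ->
    adjoin (pi_right b) y mu = 0 ->
  forall P, adjoin (pi_left b) x P = 0 <-> adjoin (pi_right b) y P = 0.
Proof.
move=> min_mu muy P; split; last first.
  exact: minimal_relation_converse (@pi_eq0 b) min_mu muy.
apply: (minimal_relation_specialize _ min_mu _ muy); first by move=> g /pi_eq0.
by case: min_mu => + _ _; apply: contraNneq => /pi_eq0 ->.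
Qed.

(** The condition on [S 0 v] makes [S] the graph of a ring morphism, possibly not injective. Pairs
    are adjoined one at a time while the graph stays inside [S]; algebraicity of the first entries
    is what makes the result an isomorphism. *)
Lemma pi_extend_specialization b (S : K -> K -> Prop) (s : seq (K * K)) :
    subring_rel S -> (forall v, S 0 v -> v = 0) ->
    (forall u v, pi_rel b u v -> S u v) ->
    (forall w, w \in s -> S w.1 w.2 /\ algebraic_over (pi_left b) w.1) ->
  exists2 b', pi_le b b' & forall w, w \in s -> pi_rel b' w.1 w.2.
Proof.
move=> subS S0 Sb ss; suff [b' [bb' _ b's]] : exists b', [/\ pi_le b b',
    forall u v, pi_rel b' u v -> S u v & forall w, w \in s -> pi_rel b' w.1 w.2].
  by exists b'.
elim: s => [|[x y] s IHs] in ss *; first by exists b; split.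
have [|b' [bb' Sb' b's]] := IHs; first by move=> w ws; apply: ss; rewrite inE ws orbT.
have [/= Sxy algx] := ss _ (mem_head _ _).
have [|mu min_mu] := @exists_minimal_relation _ _ (pi_left b') x.
  apply: algebraic_over_sub algx => g.
  by have [|g' g'l _] := bb' (pi_left b g) (pi_right b g); [exists g | exists g'].
(* [S] relates the value of [mu] at [x], which is 0, to its value at [y]. *)
have muy : adjoin (pi_right b') y mu = 0.
  case: min_mu => _ mux _; apply: S0; rewrite -mux.
  by apply: subring_rel_adjoin => // g; apply: Sb'; exists g.
have [b'' [b'b'' b''xy Sb'']] := pi_adjoin (pi_adjoin_root min_mu muy).
exists b''; split; first exact: pi_le_trans b'b''.
- exact: Sb''.
- by move=> w; rewrite inE => /orP[/eqP -> //|/b's/b'b''].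
Qed.

Hypothesis uncountableK : ~ countable [set: K].

(** Countably many polynomials have only countably many roots altogether. *)
Lemma exists_transcendental (G : comNzRingType) (a : {rmorphism G -> K}) :
  (exists f : G -> nat, injective f) -> exists x, ~ algebraic_over a x.
Proof.
move=> Gnat; apply/not_existsP => algK; apply: uncountableK.
have [f f_inj] := poly_injective_nat Gnat.
have -> : [set: K]%classic = (\bigcup_(P in [set P | map_poly a P != 0])
    [set x | root (map_poly a P) x])%classic.
  apply/seteqP; split => // x _; have /contrapT[P P0 Px] := algK x.
  by exists P => //=; apply/eqP.
apply: bigcup_countable.
  by apply/countable_injP; exists f => P Q _ _ /f_inj.
move=> P /= P0; have [r rE] := closed_field_poly_normal (map_poly a P).
apply: (@sub_countable _ _ _ [set` r]%classic); last exact/finite_set_countable/finite_seq.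
apply: subset_card_le => x /=; rewrite rE rootZ ?lead_coef_eq0 //.
by rewrite root_prod_XsubC.
Qed.

(** An algebraic [x] is sent to a root of its transported minimal relation, a transcendental one to
    any element transcendental over the right-hand image. *)
Lemma pi_extend1 b x : exists2 b', pi_le b b' & exists y, pi_rel b' x y.
Proof.
have [algx|trx] := EM (algebraic_over (pi_left b) x).
  have [mu min_mu] := exists_minimal_relation algx.
  have [lead0 mux _] := min_mu.
  have blead0 : pi_right b (lead_coef mu) != 0.
    by apply: contraNneq lead0 => /pi_eq0 ->.
  have [|y muy] := closed_rootP (map_poly (pi_right b) mu) _.
    rewrite size_map_poly_id0 // gtn_eqF //.
    exact: size_minimal_relation_gt1 min_mu.
  have [b' [bb' b'xy _]] := pi_adjoin (pi_adjoin_root min_mu (eqP muy)).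
  by exists b' => //; exists y.
have [y try] := exists_transcendental (pi_right b) (pi_countable b).
have [|b' [bb' b'xy _]] := @pi_adjoin b x y; last by exists b' => //; exists y.
(* Transcendental elements satisfy only the relations whose coefficients are all killed, and these
   are the same on both sides. *)
have killed P : map_poly (pi_left b) P == 0 <-> map_poly (pi_right b) P == 0.
  by split => /map_poly_eq0P P0; apply/map_poly_eq0P => i; apply/pi_eq0.
move=> P; split => Pxy; rewrite adjoinE.
  have /killed/eqP -> : map_poly (pi_left b) P == 0; last by rewrite horner0.
  by apply/negPn/negP => P0; apply: trx; exists P.
have /killed/eqP -> : map_poly (pi_right b) P == 0; last by rewrite horner0.
by apply/negPn/negP => P0; apply: try; exists P.
Qed.

Lemma pi_extend b (I : finType) (f : I -> K) :
  exists2 b', pi_le b b' & exists f', forall i, pi_rel b' (f i) (f' i).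
Proof.
suff [b' bb' fs] : exists2 b', pi_le b b' &
    forall i, i \in enum I -> exists y, pi_rel b' (f i) y.
  exists b' => //; have /choice[f' f'P] : forall i, exists y, pi_rel b' (f i) y.
    by move=> i; apply: fs; rewrite mem_enum.
  by exists f'.
elim: (enum I) => [|i s [b' bb' fs]]; first by exists b.
have [b'' b'b'' [y fiy]] := pi_extend1 b' (f i).
exists b''; first exact: pi_le_trans b'b''.
move=> j; rewrite inE => /orP[/eqP -> |/fs[z /b'b'' jz]]; first by exists y.
by exists z.
Qed.
End BackAndForth.

(** * Continuation of a simple root *)

Section Tends.
Variables (R : rcfType) (T : Type) (N : R -> T -> Prop).
Hypothesis N_mono : forall r r' t, r <= r' -> N r t -> N r' t.
Implicit Types (f g : T -> R[i]) (l m : R[i]).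

(** [N r] stands for the points within [r] of an implicit base point. [T] is abstract because limits
    are taken both in one parameter and jointly in a parameter and two complex numbers. *)
Definition tends f l :=
  forall e : R, 0 < e -> exists2 r : R, 0 < r & forall t, N r t -> normc (f t - l) < e.

Lemma normc_ge0 (z : R[i]) : 0 <= normc z.
Proof. by case: z => x y; exact: sqrtr_ge0. Qed.

Lemma normc_gt0 (z : R[i]) : z != 0 -> 0 < normc z.
Proof.
by move=> z0; rewrite lt0r normc_ge0 andbT; apply: contraNneq z0 => /eq0_normc ->.
Qed.

Lemma normcD_le (z w : R[i]) : normc (z + w) <= normc z + normc w.
Proof. exact: le_normcD. Qed.

Lemma normcN (z : R[i]) : normc (- z) = normc z.
Proof. exact: normcN. Qed.

Lemma normcB (z w : R[i]) : normc (z - w) = normc (w - z).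
Proof. by rewrite -normcN opprB. Qed.

Lemma tends_cst l : tends (fun=> l) l.
Proof. by move=> e e0; exists 1 => // t _; rewrite subrr normc0. Qed.

Lemma tends_ext f g l : f =1 g -> tends f l -> tends g l.
Proof. by move=> /funext ->. Qed.

Lemma tends_add f g l m :
  tends f l -> tends g m -> tends (fun t => f t + g t) (l + m).
Proof.
move=> fl gm e e0; have e2 : 0 < e / 2 by lra.
have [r r0 rP] := fl _ e2; have [r' r'0 r'P] := gm _ e2.
exists (Num.min r r'); first by rewrite lt_min r0.
move=> t Nt; rewrite opprD addrACA; apply: le_lt_trans (normcD_le _ _) _.
rewrite [ltRHS](_ : e = e / 2 + e / 2); last by field.
by apply: ltrD; [apply: rP | apply: r'P]; apply: N_mono Nt; rewrite ge_min lexx ?orbT.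
Qed.

Lemma tends_mul f g l m :
  tends f l -> tends g m -> tends (fun t => f t * g t) (l * m).
Proof.
(* With [q = e / c < 1], the three error terms add up to at most [q * (1 + normc l + normc m)],
   which is less than [q * c = e]. *)
move=> fl gm e e0; pose c := e + 1 + normc l + normc m.
have l0 := normc_ge0 l; have m0 := normc_ge0 m.
have c1 : 1 <= c by rewrite /c; lra.
have c0 : 0 < c by lra.
have ec : 0 < e / c by exact: divr_gt0.
have [r r0 rP] := fl _ ec; have [r' r'0 r'P] := gm _ ec.
exists (Num.min r r'); first by rewrite lt_min r0.
move=> t Nt.
have /rP fe : N r t by apply: N_mono Nt; rewrite ge_min lexx.
have /r'P ge : N r' t by apply: N_mono Nt; rewrite ge_min lexx orbT.
have -> : f t * g t - l * m =
  (f t - l) * (g t - m) + (l * (g t - m) + (f t - l) * m) by ring.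
apply: le_lt_trans (normcD_le _ _) _.
apply: le_lt_trans (lerD (lexx _) (normcD_le _ _)) _.
rewrite !normcM.
have f0 := normc_ge0 (f t - l); have g0 := normc_ge0 (g t - m).
have ece : e / c * c = e by rewrite divfK // gt_eqF.
have ec1 : e / c < 1 by rewrite ltr_pdivrMr // mul1r /c; lra.
move: (e / c) ec fe ge ece ec1 => q q0 fe ge ece q1.
have h1 : normc (f t - l) * normc (g t - m) <= q * 1.
  by apply: ler_pM => //; lra.
have h2 : normc l * normc (g t - m) <= normc l * q by apply: ler_wpM2l => //; lra.
have h3 : normc (f t - l) * normc m <= q * normc m by apply: ler_wpM2r => //; lra.
have : q * c = q * e + q + normc l * q + q * normc m by rewrite /c; ring.
have : 0 < q * e by exact: mulr_gt0.
lra.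
Qed.

Lemma tends_exp f l n : tends f l -> tends (fun t => f t ^+ n) (l ^+ n).
Proof.
move=> fl; elim: n => [|n IHn]; first exact: tends_cst.
rewrite exprS; apply: tends_ext (tends_mul fl IHn) => t.
by rewrite exprS.
Qed.

Lemma tends_sum (n : nat) (f : 'I_n -> T -> R[i]) (l : 'I_n -> R[i]) :
  (forall i, tends (f i) (l i)) -> tends (fun t => \sum_i f i t) (\sum_i l i).
Proof.
elim: n f l => [|n IHn] f l fl.
  by rewrite big_ord0; apply: tends_ext (tends_cst 0) => t; rewrite big_ord0.
rewrite big_ord_recl; apply: tends_ext (tends_add (fl ord0) (IHn _ _ (fun i => fl _))).
by move=> t; rewrite big_ord_recl.
Qed.
End Tends.

(** * Roots of a polynomial depending continuously on a real parameter *)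

Section RootContinuation.
Variable R : rcfType.
Implicit Types (e s r : R) (x y z : R[i]) (p : {poly R[i]}).

Definition near_in e s0 r s := 0 <= s <= e /\ `|s - s0| < r.

Lemma near_in_mono e s0 r r' s : r <= r' -> near_in e s0 r s -> near_in e s0 r' s.
Proof. by move=> rr' [se sr]; split=> //; exact: lt_le_trans sr rr'. Qed.

Definition continuous_upto e (f : R -> R[i]) :=
  forall s0, 0 <= s0 <= e -> tends (near_in e s0) f (f s0).

Lemma continuous_upto_le e e' f : e' <= e ->
  continuous_upto e f -> continuous_upto e' f.
Proof.
move=> e'e fc s0 /andP[s00 s0e'] d d0.
have [|r r0 rP] := fc s0 _ d d0; first by rewrite s00 (le_trans s0e').
exists r => // s [/andP[s_ge0 se'] sr]; apply: rP; split => //.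
by rewrite s_ge0 (le_trans se').
Qed.

(** If all [n] roots were at distance at least [eta] from [y], the factorisation of [p] would give
    [normc p.[y]] at least [k * eta ^+ n]. *)
Lemma root_near p n k eta y : size p = n.+1 -> 0 < k -> 0 < eta ->
    k < normc p`_n -> normc p.[y] < k * eta ^+ n ->
  exists2 z, root p z & normc (z - y) < eta.
Proof.
move=> szp k0 eta0 kp py; apply: contrapT => noroot.
have [rs pE] := closed_field_poly_normal p.
have p0 : p != 0 by rewrite -size_poly_eq0 szp.
have lead0 : lead_coef p != 0 by rewrite lead_coef_eq0.
have szrs : size rs = n.
  have := congr1 (fun q : {poly R[i]} => size q) pE.
  by rewrite szp size_scale // size_prod_XsubC => -[].
have : k * eta ^+ n <= normc p.[y].
  rewrite pE hornerZ normcM; apply: ler_pM; [exact: ltW|exact: exprn_ge0 (ltW eta0)| |].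
    by rewrite lead_coefE szp ltW.
  have far z : z \in rs -> eta <= normc (y - z).
    move=> zrs; rewrite leNgt; apply/negP => near; apply: noroot; exists z.
      by rewrite pE rootZ // root_prod_XsubC.
    by rewrite normcB.
  rewrite -szrs horner_prod; elim: rs far {pE szrs} => [|z rs IHrs] far /=.
    by rewrite big_nil normc1.
  rewrite big_cons normcM exprS !hornerE; apply: ler_pM.
  - exact: ltW.
  - exact: exprn_ge0 (ltW eta0).
  - exact/far/mem_head.
  - by apply: IHrs => w wrs; apply: far; rewrite inE wrs orbT.
by rewrite leNgt py.
Qed.

(** The quotient of [p.[y] - p.[z]] by [y - z], expanded so that it makes sense for [y = z]. The
    bound [n] fixes the number of terms while [p] varies; the term [i = 0] is an empty sum. *)
Definition divided_difference n p y z : R[i] :=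
  \sum_(i < n.+1) p`_i * \sum_(j < i) y ^+ (i.-1 - j) * z ^+ j.

Lemma divided_differenceE n p y z : (size p <= n.+1)%N ->
  p.[y] - p.[z] = (y - z) * divided_difference n p y z.
Proof.
move=> szp; rewrite !(horner_coef_wide _ szp) -sumrB mulr_sumr.
by apply: eq_bigr => i _; rewrite -mulrBr subrXX mulrCA.
Qed.

Lemma divided_difference_diag n p x : (size p <= n.+1)%N ->
  divided_difference n p x x = p^`().[x].
Proof.
move=> szp; have szp' : (size p^`() <= n)%N.
  by apply: leq_trans (size_poly _ _) _; case: (size p) szp.
rewrite (horner_coef_wide _ szp') /divided_difference big_ord_recl big_ord0 mulr0 add0r.
apply: eq_bigr => i _; rewrite coef_deriv mulrnAl -mulrnAr; congr (_ * _).
rewrite (eq_bigr (fun=> x ^+ i)) => [|j _]; first by rewrite sumr_const card_ord.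
by rewrite -exprD /= subnK // -ltnS.
Qed.

(** Near the simple root [x] each [p s] has a root, by [root_near], and only one, since the divided
    difference stays away from 0. Choosing it gives [f], and existence and uniqueness around [f s0]
    give continuity. *)
Lemma root_continuation e n (p : R -> {poly R[i]}) x : 0 < e ->
    (forall s, 0 <= s <= e -> (size (p s) <= n.+1)%N) ->
    (forall i, continuous_upto e (fun s => (p s)`_i)) ->
    (p 0)`_n != 0 -> root (p 0) x -> (p 0)^`().[x] != 0 ->
  exists e' (f : R -> R[i]), [/\ 0 < e' <= e, f 0 = x, continuous_upto e' f
    & forall s, 0 <= s <= e' -> root (p s) (f s) /\ (p s)`_n != 0].
Proof.
move=> e0 szp pc lead0 px dpx.
have z0e : (0 : R) <= 0 <= e by rewrite lexx ltW.
(* Triples of a parameter near 0 and two points near [x]. *)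
pose N3 r (t : R * R[i] * R[i]) :=
  [/\ near_in e 0 r t.1.1, normc (t.1.2 - x) < r & normc (t.2 - x) < r].
have N3_mono r r' t : r <= r' -> N3 r t -> N3 r' t.
  move=> rr' [st yt zt]; split; [exact: near_in_mono st|..]; exact: lt_le_trans rr'.
have t2 : tends N3 (fun t => t.1.2) x by move=> d d0; exists d => // t [].
have t3 : tends N3 (fun t => t.2) x by move=> d d0; exists d => // t [].
have t1 i : tends N3 (fun t => (p t.1.1)`_i) (p 0)`_i.
  by move=> d d0; have [r r0 rP] := pc i 0 z0e d d0; exists r => // t [/rP].
have tD : tends N3 (fun t => divided_difference n (p t.1.1) t.1.2 t.2)
    (divided_difference n (p 0) x x).
  apply: tends_sum => // i; apply: tends_mul => //; apply: tends_sum => // j.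
  by apply: tends_mul => //; exact: tends_exp.
have [|r1 r10 uniq_near] := tD (normc (p 0)^`().[x]); first exact: normc_gt0.
(* Two distinct roots would make the divided difference 0, though it is closer to the derivative at
   [x] than the modulus of that derivative. *)
have {}uniq_near s y z : 0 <= s <= e -> s < r1 -> normc (y - x) < r1 ->
    normc (z - x) < r1 -> root (p s) y -> root (p s) z -> y = z.
  move=> se sr1 yr1 zr1 /eqP ys /eqP zs; apply/eqP; rewrite -subr_eq0.
  have /eqP := divided_differenceE y z (szp s se).
  rewrite ys zs subrr eq_sym mulf_eq0 => /orP[//|/eqP D0].
  have /uniq_near /= : N3 r1 (s, y, z).
    by split=> //; split=> //=; rewrite subr0 ger0_norm //; case/andP: se.
  by rewrite D0 sub0r normcN divided_difference_diag ?ltxx //; exact: szp.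
have [|r2 r20 lead_near] := pc n 0 z0e (normc (p 0)`_n / 2).
  by rewrite divr_gt0 // normc_gt0.
(* Half the initial leading modulus: for [s < r2] the leading coefficient stays above it, so the
   degree remains [n]. *)
pose k := normc (p 0)`_n / 2.
have k0 : 0 < k by rewrite divr_gt0 // normc_gt0.
have {}lead_near s : 0 <= s <= e -> s < r2 -> k < normc (p s)`_n.
  move=> se sr2; have /lead_near : near_in e 0 r2 s.
    by split=> //; rewrite subr0 ger0_norm //; case/andP: se.
  have := normcD_le ((p 0)`_n - (p s)`_n) (p s)`_n.
  rewrite subrK normcB /k => h1 h2; lra.
(* The value of [p s] at the root [y0] of [p s0] tends to 0 as [s] tends to [s0], so [root_near]
   applies. *)
have ex_near s0 y0 eta : 0 <= s0 <= e -> root (p s0) y0 -> 0 < eta ->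
    exists2 r, 0 < r & forall s, 0 <= s <= e -> s < r2 -> `|s - s0| < r ->
      exists2 z, root (p s) z & normc (z - y0) < eta.
  move=> s0e /eqP s0y eta0.
  have h : tends (near_in e s0) (fun s => (p s).[y0]) (p s0).[y0].
    have E s : 0 <= s <= e -> (p s).[y0] = \sum_(i < n.+1) (p s)`_i * y0 ^+ i.
      by move=> /szp/horner_coef_wide.
    have : tends (near_in e s0) (fun s => \sum_(i < n.+1) (p s)`_i * y0 ^+ i)
        (\sum_(i < n.+1) (p s0)`_i * y0 ^+ i).
      apply: tends_sum => [|i]; first exact: near_in_mono.
      apply: tends_mul; [exact: near_in_mono|exact: pc|exact: tends_cst].
    rewrite -E // => hs d d0; have [r r0 rP] := hs d d0.
    by exists r => // s sr; rewrite E; [apply: rP | case: sr].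
  have [|r r0 rP] := h (k * eta ^+ n); first by rewrite mulr_gt0 // exprn_gt0.
  exists r => // s se sr2 sr.
  have lead_s := lead_near s se sr2.
  apply: (@root_near _ n k) => //.
    apply/eqP; rewrite eqn_leq szp // ltnNge; apply/negP => /leq_sizeP/(_ n (leqnn n)) pn0.
    by move: lead_s; rewrite pn0 normc0; lra.
  by have := rP s; rewrite s0y subr0; apply.
have [r3 r30 ex3] := ex_near 0 x r1 z0e px r10.
(* Halving the radii makes the bounds strict up to and including [s = e']. *)
pose e' := Num.min e (Num.min (r1 / 2) (Num.min (r2 / 2) (r3 / 2))).
have e'P : [/\ 0 < e', e' <= e, e' < r1, e' < r2 & e' < r3].
  rewrite /e' !lt_min !gt_min !ge_min lexx e0.
  have -> : 0 < r1 / 2 by lra.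
  have -> : 0 < r2 / 2 by lra.
  have -> : 0 < r3 / 2 by lra.
  have -> : r1 / 2 < r1 by lra.
  have -> : r2 / 2 < r2 by lra.
  have -> : r3 / 2 < r3 by lra.
  by rewrite !orbT.
case: e'P => e'0 e'e e'r1 e'r2 e'r3.
have in_e s : 0 <= s <= e' -> [/\ 0 <= s <= e, s < r1, s < r2 & `|s - 0| < r3].
  move=> /andP[s0 se']; rewrite s0 subr0 ger0_norm //.
  by split; [exact: le_trans e'e | exact: le_lt_trans e'r1
    | exact: le_lt_trans e'r2 | exact: le_lt_trans e'r3].
have /choice[f fP] s : exists z, 0 <= s <= e' -> root (p s) z /\ normc (z - x) < r1.
  have [se'|] := boolP (0 <= s <= e'); last by exists 0.
  have [se sr1 sr2 sr3] := in_e s se'.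
  by have [z pz zx] := ex3 s se sr2 sr3; exists z.
have z0e' : (0 : R) <= 0 <= e' by rewrite lexx ltW.
exists e', f; split; first by rewrite e'0.
- have [se sr1 _ _] := in_e 0 z0e'; have [f0 f0x] := fP 0 z0e'.
  by apply: (uniq_near 0) => //; rewrite subrr normc0.
- move=> s0 s0e' d d0; have [s0e _ _ _] := in_e s0 s0e'; have [fs0 fs0x] := fP s0 s0e'.
  (* A root this close to [f s0] is also within [r1] of [x], hence equals [f s] by uniqueness. *)
  pose eta := Num.min d (r1 - normc (f s0 - x)).
  have eta0 : 0 < eta by rewrite lt_min d0 subr_gt0.
  have [r r0 rP] := ex_near s0 (f s0) eta s0e fs0 eta0.
  exists r => // s [se' sr]; have [se sr1 sr2 _] := in_e s se'.
  have [z pz] := rP s se sr2 sr; rewrite lt_min => /andP[zd zr1].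
  suff -> : f s = z by [].
  have [fs fsx] := fP s se'; apply: (uniq_near s) => //.
  have -> : z - x = (z - f s0) + (f s0 - x) by rewrite addrA subrK.
  by apply: le_lt_trans (normcD_le _ _) _; rewrite -ltrBrDr.
- move=> s se'; have [se _ sr2 _] := in_e s se'; split; first by case: (fP s se').
  apply: contraTneq (lead_near s se sr2) => ->; rewrite normc0 -leNgt.
  exact: ltW.
Qed.
End RootContinuation.

(** * Curves of ring morphisms *)

Section Curves.
Variable R : rcfType.
Implicit Types (s e : R) (f g : R -> R[i]).

(* [cv_eq0] says that each [cv_map s] factors through the image of [cv_map 0]:
   relations that hold at the start of the curve hold all along it. *)
Record curve := Curve {
  cv_dom : comNzRingType;
  cv_len : R;
  cv_len_gt0 : 0 < cv_len;
  cv_map : R -> {rmorphism cv_dom -> R[i]};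
  cv_continuous : forall u, continuous_upto cv_len (fun s => cv_map s u);
  cv_eq0 : forall u, cv_map 0 u = 0 -> forall s, 0 <= s <= cv_len -> cv_map s u = 0 }.

Implicit Types c : curve.

Definition cv_has c f :=
  exists u, forall s, 0 <= s <= cv_len c -> cv_map c s u = f s.

Definition cv_le c c' :=
  cv_len c' <= cv_len c /\ forall f, cv_has c f -> cv_has c' f.

Lemma cv_le_trans c c' c'' : cv_le c c' -> cv_le c' c'' -> cv_le c c''.
Proof.
move=> [le1 has1] [le2 has2]; split; first exact: le_trans le1.
by move=> f /has1/has2.
Qed.

Lemma cv_hasB c f g : cv_has c f -> cv_has c g -> cv_has c (fun s => f s - g s).
Proof. by move=> [u uf] [v vg]; exists (u - v) => s sc; rewrite rmorphB uf ?vg. Qed.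

Lemma cv_hasX c f n : cv_has c f -> cv_has c (fun s => f s ^+ n).
Proof. by move=> [u uf]; exists (u ^+ n) => s sc; rewrite rmorphXn /= uf. Qed.

Lemma cv_has_sum c (I : finType) (f : I -> R -> R[i]) :
  (forall i, cv_has c (f i)) -> cv_has c (fun s => \sum_i f i s).
Proof.
move=> /choice[u uf]; exists (\sum_i u i) => s sc.
by rewrite rmorph_sum; apply: eq_bigr => i _; exact: uf.
Qed.

Lemma cv_in0 c : (0 : R) <= 0 <= cv_len c.
Proof. by rewrite lexx ltW // cv_len_gt0. Qed.

(** The difference is represented by an element that vanishes at 0, hence along the whole curve. *)
Lemma cv_has_eq c f g : cv_has c f -> cv_has c g -> f 0 = g 0 ->
  forall s, 0 <= s <= cv_len c -> f s = g s.
Proof.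
move=> cf cg fg0 s sc; have [u uP] := cv_hasB cf cg.
apply/eqP; rewrite -subr_eq0 -uP //; apply/eqP.
by apply: cv_eq0 => //; rewrite uP ?cv_in0 // fg0 subrr.
Qed.

Lemma continuous_upto_eq e f g : (forall s, 0 <= s <= e -> f s = g s) ->
  continuous_upto e f -> continuous_upto e g.
Proof.
move=> fg fc s0 s0e d d0; have [r r0 rP] := fc s0 s0e d d0.
by exists r => // s sr; rewrite -!fg //; [exact: rP | case: sr].
Qed.

Lemma cv_has_continuous c f : cv_has c f -> continuous_upto (cv_len c) f.
Proof. by case=> u uf; apply: continuous_upto_eq uf _; exact: cv_continuous. Qed.

Lemma cv_adjoin c e f : 0 < e <= cv_len c -> continuous_upto e f ->
    (forall P, adjoin (cv_map c 0) (f 0) P = 0 ->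
       forall s, 0 <= s <= e -> adjoin (cv_map c s) (f s) P = 0) ->
  exists2 c', cv_le c c' & cv_has c' f.
Proof.
move=> /andP[e0 ec] fc eq0.
have cont P : continuous_upto e (fun s => adjoin (cv_map c s) (f s) P).
  move=> s0 s0e; elim/poly_ind: P => [|P u IHP].
    by rewrite rmorph0; apply: tends_ext (tends_cst _ 0) => s; rewrite rmorph0.
  rewrite adjoin_MXaddC; apply: (@tends_ext _ _ _
    (fun s => adjoin (cv_map c s) (f s) P * f s + cv_map c s u)).
    by move=> s; rewrite adjoin_MXaddC.
  apply: tends_add; first exact: near_in_mono.
    by apply: tends_mul; [exact: near_in_mono | | exact: fc].
  by apply: (continuous_upto_le ec) s0e; exact: cv_continuous.
exists (Curve e0 cont eq0).
- split=> // g [u ug]; exists u%:P => s /= /andP[s0 se].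
  by rewrite -[LHS]/(adjoin _ _ _) adjoinC ug // s0 (le_trans se).
- by exists 'X => s _; exact: adjoinX.
Qed.

(** The only relations of [f 0] have all their coefficients killed at 0, and these coefficients stay
    killed; so [f] may move freely. *)
Lemma cv_adjoin_transcendental c f : continuous_upto (cv_len c) f ->
    ~ algebraic_over (cv_map c 0) (f 0) ->
  exists2 c', cv_le c c' & cv_has c' f.
Proof.
move=> fc trf; apply: (@cv_adjoin c (cv_len c)) => //.
  by rewrite cv_len_gt0 lexx.
move=> P Pf s sc; have P0 : map_poly (cv_map c 0) P == 0.
  by apply/negPn/negP => P0; apply: trf; exists P.
rewrite adjoinE (_ : map_poly _ P = 0) ?horner0 //.
by apply/eqP/map_poly_eq0P => i; apply: cv_eq0 => //; apply/map_poly_eq0P.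
Qed.

(** A transcendental [x] is kept constant. An algebraic one is a simple root of its minimal
    relation, in characteristic 0, and is continued as a root of it; minimality makes every other
    relation follow. *)
Lemma cv_extend1 c x : exists2 c', cv_le c c' & exists2 f, cv_has c' f & f 0 = x.
Proof.
have [algx|trx] := EM (algebraic_over (cv_map c 0) x); last first.
  have [|//|c' cc' c'x] := @cv_adjoin_transcendental c (fun=> x).
    by move=> s0 _; exact: tends_cst.
  by exists c' => //; exists (fun=> x).
have [mu min_mu] := exists_minimal_relation algx.
have [lead0 mux _] := min_mu.
have [|s _|||||e [f [ec f0 fc fP]]] := @root_continuation R (cv_len c) (size mu).-1
  (fun s => map_poly (cv_map c s) mu) x.
- exact: cv_len_gt0.
- by apply: leq_trans (size_poly _ _) _; case: (size mu).
- move=> i; apply: continuous_upto_eq (@cv_continuous c mu`_i) => s _.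
  by rewrite coef_map.
- by rewrite coef_map -lead_coefE.
- exact/eqP.
- by apply: minimal_relation_deriv min_mu => //; exact: pchar_num.
have [|c' cc' c'f] := @cv_adjoin c e f ec fc; last by exists c' => //; exists f.
rewrite f0 => P Px s se; have [fs leads0] := fP s se.
apply: (minimal_relation_specialize _ min_mu _ (eqP fs)) Px.
  move=> u u0; apply: cv_eq0 => //; case/andP: se => -> /le_trans -> //.
  by case/andP: ec.
by rewrite coef_map -lead_coefE in leads0.
Qed.

Lemma cv_extend c (I : finType) (x : I -> R[i]) :
  exists2 c', cv_le c c' &
    exists F : I -> R -> R[i], (forall i, cv_has c' (F i)) /\ (forall i, F i 0 = x i).
Proof.
suff [c' cc' fs] : exists2 c', cv_le c c' &
    forall i, i \in enum I -> exists2 f, cv_has c' f & f 0 = x i.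
  exists c' => //; have /choice[f fP] i : exists f, cv_has c' f /\ f 0 = x i.
    by have [|f fc f0] := fs i; [rewrite mem_enum | exists f].
  by exists f; split => i; case: (fP i).
elim: (enum I) => [|i l [c' cc' fs]]; first by exists c.
have [c'' c'c'' [f fc f0]] := cv_extend1 c' (x i).
exists c''; first exact: cv_le_trans c'c''.
move=> j; rewrite inE => /orP[/eqP -> |/fs[g gc g0]]; first by exists f.
by exists g => //; case: c'c'' => _; apply.
Qed.
End Curves.

(** * Evaluation of polynomials at a realisation *)

(** A countable [R] would give the unit interval Lebesgue measure 0. *)
Lemma uncountable_complex (R : realType) : ~ countable [set: R[i]].
Proof.
move=> Cnat; have Rnat : countable [set: R].
  move/countable_injP: Cnat => [f f_inj]; apply/countable_injP.
  exists (f \o real_complex R) => x y _ _ /= /f_inj.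
  by rewrite !inE => /(_ I I)/complexI.
have : lebesgue_measure `[(0 : R), 1]%classic = 0%E.
  by apply: countable_lebesgue_measure0; apply: sub_countable Rnat; exact: subset_card_le.
by rewrite lebesgue_measure_itv /= lte_fin ltr01 oppr0 adde0 => /eqP; rewrite eqe oner_eq0.
Qed.

Lemma within_continuous_of_upto (R : realType) (e : R) (f : R -> R[i]) :
  0 < e -> continuous_upto e f ->
  {within `[0, 1], continuous (fun t => f (t * e))}%classic.
Proof.
move=> e0 fc; apply/subspace_continuousP => t /=; rewrite in_itv /= => t01.
have in_e s : 0 <= s <= 1 -> 0 <= s * e <= e.
  by move=> /andP[s0 s1]; rewrite mulr_ge0 ?(ltW e0) //= ler_piMl // ltW.
apply/cvg_ballP => r r0; apply/nbhs_ballP.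
(* Balls of [R[i]] have their radii in [R[i]]; a positive one is real. *)
have [e1 rE] : exists e1, r = e1%:C.
  by exists (complex.Re (r : R[i])); rewrite RRe_real //; exact: gtr0_real.
have e10 : 0 < e1 by rewrite -ltcR -rE.
have [q q0 qP] := fc _ (in_e t t01) _ e10.
exists (q / e) => /=; first exact: divr_gt0.
move=> s /= ts; rewrite in_itv /= => s01.
rewrite /ball /= rE distrC -[`|_|]/((normc _)%:C) ltcR.
apply: qP; split; first exact: in_e.
rewrite -mulrBl normrM (gtr0_norm e0) -ltr_pdivlMr // distrC.
exact: ts.
Qed.

Section Evaluation.
Variables (R : realType) (V : finType) (d : nat).
Implicit Types (p q : realisation R V d) (E : rel V).

Local Notation coord_ring := {mpoly rat[#|{: V * 'I_d}|]}.
Local Notation edge_ring := {mpoly rat[#|{: V * V}|]}.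

Definition ev p : {rmorphism coord_ring -> R[i]} := mmap (@ratr R[i]) (coords p).

Definition coordX (v : V) (k : 'I_d) : coord_ring := 'X_(enum_rank (v, k)).

Lemma ev_coordX p v k : ev p (coordX v k) = p v 0 k.
Proof. by rewrite /= mmapX mmap1U /coords enum_rankK. Qed.

Definition sqdist p v w := sqnorm (p v - p w).

Definition sqdistX v w : coord_ring := \sum_k (coordX v k - coordX w k) ^+ 2.

Lemma ev_sqdistX p v w : ev p (sqdistX v w) = sqdist p v w.
Proof.
rewrite rmorph_sum; apply: eq_bigr => k _.
by rewrite rmorphXn rmorphB !ev_coordX !mxE.
Qed.

(* Non-edges get length 0, so that one polynomial ring serves all graphs on [V]. *)
Definition edge_lengths E p (e : 'I_#|{: V * V}|) : R[i] :=
  let vw := enum_val e in if E vw.1 vw.2 then sqdist p vw.1 vw.2 else 0.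

Definition edge_ev E p : {rmorphism edge_ring -> R[i]} :=
  mmap (@ratr R[i]) (edge_lengths E p).

Definition edge_lengthsX E (e : 'I_#|{: V * V}|) : coord_ring :=
  let vw := enum_val e in if E vw.1 vw.2 then sqdistX vw.1 vw.2 else 0.

(** Turns polynomials in the edge lengths into polynomials in the coordinates, to which genericity
    applies. *)
Definition edge_poly E : {rmorphism edge_ring -> coord_ring} :=
  mmap (@mpolyC _ _) (edge_lengthsX E).

Lemma ev_edge_poly E p g : ev p (edge_poly E g) = edge_ev E p g.
Proof.
rewrite -[edge_poly E g]/(\sum_(m <- msupp g) (g@_m)%:MP * mmap1 (edge_lengthsX E) m).
rewrite -[edge_ev E p g]/(\sum_(m <- msupp g) ratr g@_m * mmap1 (edge_lengths E p) m).
rewrite rmorph_sum; apply: eq_bigr => m _.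
rewrite rmorphM [X in X * _]mmapC; congr (_ * _).
rewrite rmorph_prod; apply: eq_bigr => e _; rewrite rmorphXn; congr (_ ^+ _).
rewrite /edge_lengthsX /edge_lengths; case: ifP => _; last exact: rmorph0.
exact: ev_sqdistX.
Qed.

Lemma equivalent_edge_lengths E p q : equivalent E p q -> edge_lengths E p = edge_lengths E q.
Proof. by move=> eqpq; apply/funext => e; rewrite /edge_lengths; case: ifP => // /eqpq. Qed.

Lemma sqnorm_mulmx (x : 'rV[R[i]]_d) (A : 'M[R[i]]_d) :
  A *m A^T = 1%:M -> sqnorm (x *m A) = sqnorm x.
Proof.
have sqnormE (y : 'rV[R[i]]_d) : sqnorm y = (y *m y^T) 0 0.
  by rewrite mxE; apply: eq_bigr => k _; rewrite mxE expr2.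
by move=> AA; rewrite !sqnormE trmx_mul mulmxA -(mulmxA x) AA mulmx1.
Qed.

Lemma congruent_sqdist p q : congruent p q -> forall v w, sqdist p v w = sqdist q v w.
Proof.
move=> [A [b [AtA [_ qE]]]] v w; rewrite /sqdist !qE opprD addrACA subrr addr0.
by rewrite -mulmxBl sqnorm_mulmx // trmxK.
Qed.

(** A transcendental squared distance could be shifted by [s] over the constant curve of edge
    lengths. Extending the curve to the coordinates of [p] yields a continuous motion that preserves
    edge lengths but not this distance. *)
Lemma rigid_algebraic E p : rigid E p ->
  forall v w, algebraic_over (edge_ev E p) (sqdist p v w).
Proof.
move=> rig v w; apply: contrapT => tr.
have cont_cst g : continuous_upto 1 (fun _ : R => edge_ev E p g).
  by move=> s0 _; exact: tends_cst.
pose c0 := @Curve R _ 1 ltr01 (fun=> edge_ev E p) cont_cst (fun u u0 _ _ => u0).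
have cont_shift : continuous_upto 1 (fun s : R => sqdist p v w + s%:C).
  move=> s0 _; apply: tends_add; first exact: near_in_mono.
    exact: tends_cst.
  move=> e e0; exists e => // s [_ se].
  by rewrite -rmorphB /= /normc /= expr0n addr0 sqrtr_sqr.
have [|c1 [_ c01] c1vw] := @cv_adjoin_transcendental R c0 _ cont_shift.
  by rewrite /= addr0.
have [c [c1c_len c1c] [F [cF F0]]] :=
  @cv_extend R c1 (V * 'I_d)%type (fun vk => p vk.1 0 vk.2).
pose e := cv_len c; pose gam s : realisation R V d := fun v => \row_k F (v, k) s.
have gam0 : gam 0 = p.
  by apply/funext => u; apply/rowP => k; rewrite mxE F0.
have c_sqdist u u' : cv_has c (fun s => sqdist (gam s) u u').
  rewrite (_ : (fun s => _) = (fun s => \sum_k (F (u, k) s - F (u', k) s) ^+ 2)).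
    by apply: cv_has_sum => k; apply/cv_hasX/cv_hasB.
  by apply/funext => s; apply: eq_bigr => k _; rewrite !mxE.
have e0 : 0 < e := cv_len_gt0 c.
have in_e t : 0 <= t <= 1 -> 0 <= t * e <= e.
  by move=> /andP[t0 t1]; rewrite mulr_ge0 ?(ltW e0) //= ler_piMl // ltW.
have /(_ 1) : forall t : R, 0 <= t <= 1 -> congruent p (gam (t * e)).
  apply: (rig (fun t => gam (t * e))).
  - by rewrite mul0r.
  - move=> u k; rewrite (_ : (fun t => _) = (fun t => F (u, k) (t * e))).
      by apply: within_continuous_of_upto => //; exact: cv_has_continuous.
    by apply/funext => t; rewrite mxE.
  (* The length of [uu'] and its constant initial value both belong to the curve and agree at 0,
     hence everywhere. *)
  - move=> t t01 u u' Euu'.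
    have cst : cv_has c (fun=> sqdist p u u').
      apply/c1c/c01; exists 'X_(enum_rank (u, u')) => s _ /=.
      by rewrite mmapX mmap1U /edge_lengths enum_rankK /= Euu'.
    have := @cv_has_eq _ c _ _ cst (c_sqdist u u') _ (t * e) (in_e t t01).
    by apply; rewrite gam0.
rewrite lexx ler01 mul1r => /(_ isT)/congruent_sqdist/(_ v w).
(* At the end of the curve the shifted distance gives [sqdist p v w + e], whereas congruence gives
   [sqdist p v w]. *)
have := @cv_has_eq _ c _ _ (c_sqdist v w) (c1c _ c1vw) _ e.
rewrite gam0 /= addr0 lexx (ltW e0) => -> // /(congr1 (fun z => z - sqdist p v w)).
rewrite subrr addrAC subrr add0r => /esym/complexI e00.
by rewrite e00 ltxx in e0.
Qed.
End Evaluation.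

(** * Congruence *)

Lemma mpoly_injective_nat (n : nat) : exists f : {mpoly rat[n]} -> nat, injective f.
Proof.
exists (fun P => pickle [seq (P@_m, val (val m)) | m <- msupp P]) => P Q.
move/(pcan_inj pickleK) => PQ.
(* A polynomial is rebuilt from its list of coefficients and exponent sequences; [insubd] recovers
   each exponent tuple. *)
have sum_code (S : {mpoly rat[n]}) : S =
    \sum_(cm <- [seq (S@_m, val (val m)) | m <- msupp S])
      cm.1 *: 'X_[(Multinom (insubd [tuple of nseq n 0%N] cm.2))].
  rewrite big_map [LHS]mpolyE; apply: eq_bigr => m _ /=; congr (_ *: 'X_[_]).
  by apply: val_inj => /=; rewrite valKd.
by rewrite (sum_code P) PQ -sum_code.
Qed.

(** The determinants of [P] and [Q] have equal squares, so [Q] is invertible too, and [A] is the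
    inverse of [P] times [Q]. *)
Lemma gram_orthogonal (F : fieldType) (n : nat) (P Q : 'M[F]_n) :
    P *m P^T = Q *m Q^T -> \det P != 0 ->
  exists2 A, A *m A^T = 1%:M &
    forall x y : 'rV_n, x *m P^T = y *m Q^T -> y = x *m A.
Proof.
move=> gram detP0; have detQ0 : \det Q != 0.
  have := congr1 determinant gram; rewrite !det_mulmx !det_tr => /eqP.
  by apply: contraTneq => ->; rewrite mul0r mulf_eq0 orbb.
have unitP : P \in unitmx by rewrite unitmxE unitfE.
have unitQ : Q^T \in unitmx by rewrite unitmx_tr unitmxE unitfE.
exists (invmx P *m Q) => [|x y xy].
  rewrite trmx_mul mulmxA -(mulmxA _ Q) -gram mulmxA mulVmx // mul1mx.
  by rewrite -trmx_mul mulVmx // trmx1.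
by apply: (can_inj (mulmxK unitQ)); rewrite -xy -!mulmxA -gram mulKmx.
Qed.

Section Congruence.
Variables (R : realType) (V : finType) (d : nat).
Implicit Types (p q r : realisation R V d).

Lemma congruent_sym p q : congruent p q -> congruent q p.
Proof.
move=> [A [b [AtA [AAt qE]]]]; exists A^T, (- b *m A); rewrite trmxK; do 2!split=> //.
by move=> v; rewrite qE mulmxDl -mulmxA AtA mulmx1 mulNmx addrK.
Qed.

Lemma congruent_trans p q r : congruent p q -> congruent q r -> congruent p r.
Proof.
move=> [A [b [AtA [AAt qE]]]] [B [c [BtB [BBt rE]]]].
exists (B *m A), (b *m B^T + c); rewrite trmx_mul; split; [|split].
- by rewrite -mulmxA (mulmxA B^T) BtB mul1mx.
- by rewrite -mulmxA (mulmxA A) AAt mul1mx.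
- by move=> v; rewrite rE qE mulmxDl mulmxA addrA.
Qed.

(** Polarisation. *)
Lemma dot_eq (x y x' y' : 'rV[R[i]]_d) : sqnorm x = sqnorm x' -> sqnorm y = sqnorm y' ->
  sqnorm (x - y) = sqnorm (x' - y') ->
  \sum_k x 0 k * y 0 k = \sum_k x' 0 k * y' 0 k.
Proof.
have polar (u w : 'rV[R[i]]_d) :
    sqnorm (u - w) = sqnorm u + sqnorm w - (\sum_k u 0 k * w 0 k) *+ 2.
  rewrite -sumrMnl -big_split -sumrB; apply: eq_bigr => k _ /=.
  by rewrite !mxE sqrrB addrAC.
rewrite !polar => -> -> /addrI/oppr_inj/eqP.
by rewrite eqr_pMn2r // => /eqP.
Qed.

(** Squared distances determine the dot products of the vectors issued from a vertex [v0]. For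
    generic [p], [d] of these vectors form a basis, and equality of Gram matrices provides the
    orthogonal map. *)
Lemma sqdist_congruent p q : generic p -> (d < #|V|)%N ->
  (forall v w, sqdist p v w = sqdist q v w) -> congruent p q.
Proof.
move=> genp ltdV pq; pose u (i : 'I_d.+1) : V := enum_val (widen_ord ltdV i).
have u_inj : injective u by move=> i j /enum_val_inj/(congr1 val)/= /val_inj.
pose v0 := u ord0; pose w (i : 'I_d) := u (lift ord0 i).
pose g (x : realisation R V d) v : 'rV[R[i]]_d := x v - x v0.
pose M (x : realisation R V d) : 'M[R[i]]_d := \matrix_(i, j) g x (w i) 0 j.
pose MX : 'M[{mpoly rat[#|{: V * 'I_d}|]}]_d := \matrix_(i, j) (coordX (w i) j - coordX v0 j).
have mapMX x : map_mx (ev x) MX = M x.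
  by apply/matrixP => i j; rewrite !mxE rmorphB !ev_coordX.
have detMX0 : \det MX != 0.
  (* The determinant is a nonzero polynomial because it is 1 when [v0] is at the origin and the
     [w j] at the standard basis vectors. *)
  pose x : realisation R V d := fun v => \row_j (v == w j)%:R.
  apply/eqP => /(congr1 (ev x)); rewrite -det_map_mx mapMX rmorph0.
  rewrite (_ : M x = 1%:M) ?det1; first by apply/eqP/oner_neq0.
  apply/matrixP => i j; rewrite !mxE !(inj_eq u_inj) (inj_eq (@lift_inj _ ord0)).
  by rewrite (negPf (neq_lift _ _)) subr0.
have detp0 : \det (M p) != 0 by rewrite -mapMX det_map_mx; exact: genp.
have dotE v v' : \sum_k g p v 0 k * g p v' 0 k = \sum_k g q v 0 k * g q v' 0 k.
  apply: dot_eq; [exact: pq | exact: pq |].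
  by rewrite /g !opprB !addrA !subrK; exact: pq.
have gM v : g p v *m (M p)^T = g q v *m (M q)^T.
  apply/rowP => i; have gME x : (g x v *m (M x)^T) 0 i = \sum_k g x v 0 k * g x (w i) 0 k.
    by rewrite mxE; apply: eq_bigr => k _; rewrite [(M x)^T _ _]mxE [M x _ _]mxE.
  by rewrite !gME dotE.
have gram : M p *m (M p)^T = M q *m (M q)^T.
  apply/row_matrixP => i; rewrite !row_mul.
  have rowM x : row i (M x) = g x (w i) by apply/rowP => j; rewrite [LHS]mxE [LHS]mxE.
  by rewrite !rowM gM.
have [At AtA AtE] := gram_orthogonal gram detp0.
exists At^T, (q v0 - p v0 *m At); rewrite trmxK; split=> //; split.
  exact: mulmx1C.
move=> v; have := AtE _ _ (gM v); rewrite /g mulmxBl => /(canRL (subrK _)) ->.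
by rewrite -addrA [- _ + _]addrC.
Qed.
End Congruence.

(** * Realisations equivalent to a generic one *)

Section Realisations.
Variables (R : realType) (V : finType) (d : nat).
Implicit Types (p q r : realisation R V d) (E : rel V) (b : partial_iso R[i]).

Lemma generic_eq0 p P : generic p -> ev p P = 0 -> P = 0.
Proof. by move=> genp /eqP P0; apply/eqP; apply: contraTT P0; exact: genp. Qed.

(** For generic [p], the graph of the specialisation of the coordinates of [p] to those of [q]. *)
Definition ev_rel p q (x y : R[i]) := exists2 P, ev p P = x & ev q P = y.

Lemma ev_rel_subring p q : subring_rel (ev_rel p q).
Proof.
split; first by exists 1; exact: rmorph1.
- by move=> _ _ _ _ [P <- <-] [Q <- <-]; exists (P - Q); exact: rmorphB.
- by move=> _ _ _ _ [P <- <-] [Q <- <-]; exists (P * Q); exact: rmorphM.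
Qed.

Lemma ev_rel_sqdist p q v w : ev_rel p q (sqdist p v w) (sqdist q v w).
Proof. by exists (sqdistX d v w); exact: ev_sqdistX. Qed.

Lemma ev_rel_edge_ev E p q g : equivalent E p q ->
  ev_rel p q (edge_ev E p g) (edge_ev E p g).
Proof.
move=> pq; exists (edge_poly d E g); first exact: ev_edge_poly.
by rewrite ev_edge_poly /edge_ev (equivalent_edge_lengths pq).
Qed.

Lemma ev_rel0 p q y : generic p -> ev_rel p q 0 y -> y = 0.
Proof. by move=> genp [P /(generic_eq0 genp) -> <-]; exact: rmorph0. Qed.

(** For generic [p] the relation is a polynomial identity in the coordinates, so it holds at [q],
    whose edge lengths are the same. *)
Lemma sqdist_root E p q P v w : generic p -> equivalent E p q ->
  adjoin (edge_ev E p) (sqdist p v w) P = 0 ->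
  adjoin (edge_ev E p) (sqdist q v w) P = 0.
Proof.
move=> genp pq P0; apply: (ev_rel0 genp (q := q)); rewrite -[X in ev_rel _ _ X]P0.
apply: subring_rel_adjoin; [exact: ev_rel_subring | | exact: ev_rel_sqdist].
by move=> g; exact: ev_rel_edge_ev.
Qed.

Definition pi_related b p q := forall v k, pi_rel b (p v 0 k) (q v 0 k).

Lemma pi_related_le b b' p q : pi_le b b' -> pi_related b p q -> pi_related b' p q.
Proof. by move=> bb' pq v k; exact/bb'/pq. Qed.

Lemma pi_related_sqdist b p q v w : pi_related b p q ->
  pi_rel b (sqdist p v w) (sqdist q v w).
Proof.
move=> pq; apply: (subring_rel_sum (pi_rel_subring b)) => k.
rewrite !mxE; apply: (subring_relX (pi_rel_subring b)).
exact: (subring_relB (pi_rel_subring b) (pq v k) (pq w k)).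
Qed.

Lemma pi_extend_realisations b n (r : 'I_n -> realisation R V d) :
  exists2 b', pi_le b b' &
    exists r' : 'I_n -> realisation R V d, forall j, pi_related b' (r j) (r' j).
Proof.
have [b' bb' [f fP]] := pi_extend (@uncountable_complex R) b
  (fun jvk : 'I_n * V * 'I_d => r jvk.1.1 jvk.1.2 0 jvk.2).
exists b' => //; exists (fun j v => \row_k f (j, v, k)) => j v k.
by rewrite mxE; exact: (fP (j, v, k)).
Qed.

Lemma pi_extend_realisation b p :
  exists2 b', pi_le b b' & exists q, pi_related b' p q.
Proof.
have [b' bb' [r' rP]] := pi_extend_realisations b (fun _ : 'I_1 => p).
by exists b' => //; exists (r' ord0).
Qed.

(** Since [b] fixes the rationals, a polynomial vanishing at [q] vanishes at [p]. *)
Lemma pi_related_generic b p q : (forall c : rat, pi_rel b (ratr c) (ratr c)) ->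
  pi_related b p q -> generic p -> generic q.
Proof.
move=> b_rat pq genp P P0; have subb := pi_rel_subring b.
have : pi_rel b (ev p P) (ev q P).
  apply: (subring_rel_sum subb) => m.
  apply: (subring_relM subb (b_rat _)).
  apply: (subring_rel_prod subb) => i.
  by apply: (subring_relX subb); exact: pq.
move=> /pi_rel_eq/(_ (subring_rel0 subb))[_ q0].
by apply: contra (genp P P0) => /eqP/q0/eqP.
Qed.

(** The identity on the ring of edge lengths extends to an isomorphism taking the squared distances
    of [p] to those of [q], by specialisation and algebraicity. Extending it to the coordinates of
    [p] produces [q']. *)
Lemma equivalent_generic E p q : generic p ->
    (forall v w, algebraic_over (edge_ev E p) (sqdist p v w)) ->
    equivalent E p q ->
  exists2 q' : realisation R V d, generic q' & forall v w, sqdist q' v w = sqdist q v w.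
Proof.
move=> genp algp pq.
pose b : partial_iso R[i] := @PartialIso _ {mpoly rat[#|{: V * V}|]}
  (mpoly_injective_nat _) (edge_ev E p) (edge_ev E p) (fun g => iff_refl _).
have [||||b1 bb1 b1P] := @pi_extend_specialization _ b (ev_rel p q)
    [seq (sqdist p vw.1 vw.2, sqdist q vw.1 vw.2) | vw <- enum {: V * V}].
- exact: ev_rel_subring.
- by move=> y; exact: ev_rel0.
- by move=> _ _ [g <- <-]; exact: ev_rel_edge_ev.
- by move=> _ /mapP[[v w] _ ->] /=; split; [exact: ev_rel_sqdist | exact: algp].
have [b2 b1b2 [q' pq']] := pi_extend_realisation b1 p.
exists q'.
  apply: pi_related_generic pq' genp => c; apply/b1b2/bb1.
  by exists c%:MP; exact: mmapC.
move=> v w; have b2vw : pi_rel b2 (sqdist p v w) (sqdist q v w).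
  by apply/b1b2/(b1P (sqdist p v w, sqdist q v w))/mapP; exists (v, w); rewrite ?mem_enum.
by have [-> //] := pi_rel_eq (pi_related_sqdist v w pq') b2vw.
Qed.

Lemma equivalent_congruent_generic E p q : (d < #|V|)%N -> generic p ->
    (forall v w, algebraic_over (edge_ev E p) (sqdist p v w)) ->
    equivalent E p q ->
  exists2 q' : realisation R V d, generic q' & congruent q' q.
Proof.
move=> ltdV genp algp pq; have [q' genq' q'q] := equivalent_generic genp algp pq.
by exists q' => //; exact: sqdist_congruent.
Qed.

(** Both [q] and [r] are compared with a generic realisation having the same squared distances. *)
Lemma equivalent_sqdist_congruent E p q r : (d < #|V|)%N -> generic p ->
    (forall v w, algebraic_over (edge_ev E p) (sqdist p v w)) ->
    equivalent E p q -> (forall v w, sqdist q v w = sqdist r v w) ->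
  congruent q r.
Proof.
move=> ltdV genp algp pq qr; have [q' genq' q'q] := equivalent_generic genp algp pq.
apply: (@congruent_trans _ _ _ _ q'); first exact/congruent_sym/sqdist_congruent.
by apply: sqdist_congruent => // v w; rewrite q'q.
Qed.

Definition sqdists p : {ffun V * V -> R[i]} := [ffun vw => sqdist p vw.1 vw.2].

(** Each squared distance of [q] is a root of a polynomial depending only on [p]; the list contains
    all tables with entries among these roots. *)
Lemma finite_sqdists E p : generic p ->
    (forall v w, algebraic_over (edge_ev E p) (sqdist p v w)) ->
  exists s : seq {ffun V * V -> R[i]}, forall q, equivalent E p q -> sqdists q \in s.
Proof.
move=> genp algp.
have /choice[rts rtsP] (vw : V * V) : exists l : seq R[i],
    forall q, equivalent E p q -> sqdist q vw.1 vw.2 \in l.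
  have [P P0 Pvw] := algp vw.1 vw.2.
  have [l lE] := closed_field_poly_normal (map_poly (edge_ev E p) P).
  exists l => q pq; have /eqP := sqdist_root genp pq Pvw.
  by rewrite adjoinE lE hornerZ mulf_eq0 lead_coef_eq0 (negPf P0) -root_prod_XsubC.
pose l := flatten (map rts (enum {: V * V})).
exists [seq [ffun vw => ssval (f vw)] | f : {ffun V * V -> seq_sub l}] => q pq.
have inl vw : sqdist q vw.1 vw.2 \in l.
  by apply/flatten_mapP; exists vw; [rewrite mem_enum | exact: rtsP].
apply/mapP; exists [ffun vw => SeqSub (inl vw)]; first by rewrite mem_enum.
by apply/ffunP => vw; rewrite !ffunE.
Qed.

(** Classes correspond to attained tables of squared distances, so one representative is chosen for
    each table in a duplicate-free list. *)
Lemma exists_num_congruence_classes E p : (d < #|V|)%N -> generic p -> rigid E p ->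
  exists n, num_congruence_classes E p n.
Proof.
move=> ltdV genp /rigid_algebraic algp; have [s sP] := finite_sqdists genp algp.
pose attained D := `[< exists2 q, equivalent E p q & sqdists q = D >].
pose s0 := undup [seq D <- s | attained D].
have /choice[r rP] (j : 'I_(size s0)) : exists q, equivalent E p q /\
    sqdists q = nth 0 s0 j.
  have := mem_nth 0 (ltn_ord j); rewrite mem_undup mem_filter => /andP[/asboolP[q pq qj] _].
  by exists q.
exists (size s0), r; split.
- by move=> j; case: (rP j).
- move=> j k /congruent_sqdist jk; apply: val_inj; apply/eqP.
  rewrite -(nth_uniq 0 (ltn_ord j) (ltn_ord k) (undup_uniq _)).
  have [_ <-] := rP j; have [_ <-] := rP k; apply/eqP/ffunP => vw.
  by rewrite !ffunE.
- move=> q pq; have qs0 : sqdists q \in s0.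
    by rewrite mem_undup mem_filter sP // andbT; apply/asboolP; exists q.
  have ltq : (index (sqdists q) s0 < size s0)%N by rewrite index_mem.
  exists (Ordinal ltq); have [pr rE] := rP (Ordinal ltq).
  apply: (equivalent_sqdist_congruent ltdV genp algp pr) => v w.
  move: rE; rewrite nth_index // => /ffunP/(_ (v, w)).
  by rewrite !ffunE.
Qed.
End Realisations.

(** * Independence of the generic realisation and divisibility *)

Section MatrixRelation.
Variables (K : closedFieldType) (b : partial_iso K).

Definition pi_relmx m n (A B : 'M[K]_(m, n)) := forall i j, pi_rel b (A i j) (B i j).

Lemma pi_relmx_mul m n k (A A' : 'M[K]_(m, n)) (B B' : 'M[K]_(n, k)) :
  pi_relmx A A' -> pi_relmx B B' -> pi_relmx (A *m B) (A' *m B').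
Proof.
move=> AA' BB' i j; rewrite !mxE; apply: (subring_rel_sum (pi_rel_subring b)) => l.
exact: (subring_relM (pi_rel_subring b)).
Qed.

Lemma pi_relmx_add m n (A A' B B' : 'M[K]_(m, n)) :
  pi_relmx A A' -> pi_relmx B B' -> pi_relmx (A + B) (A' + B').
Proof.
by move=> AA' BB' i j; rewrite !mxE; exact: (subring_relD (pi_rel_subring b)).
Qed.

Lemma pi_relmx_tr m n (A A' : 'M[K]_(m, n)) : pi_relmx A A' -> pi_relmx A^T A'^T.
Proof. by move=> AA' i j; rewrite !mxE. Qed.

Lemma pi_relmx1 n : pi_relmx (1%:M : 'M[K]_n) 1%:M.
Proof.
move=> i j; rewrite !mxE; case: (_ == _).
  exact: (subring_rel1 (pi_rel_subring b)).
exact: (subring_rel0 (pi_rel_subring b)).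
Qed.

Lemma pi_relmx_eq m n (A A' B B' : 'M[K]_(m, n)) :
  pi_relmx A A' -> pi_relmx B B' -> A = B -> A' = B'.
Proof.
move=> AA' BB' /matrixP AB; apply/matrixP => i j.
by have [-> //] := pi_rel_eq (AA' i j) (BB' i j).
Qed.
End MatrixRelation.

(** * Transport of equivalence and congruence, and the count *)

Section Transfer.
Variables (R : realType) (V : finType) (d : nat).
Implicit Types (p q r : realisation R V d) (E : rel V) (b : partial_iso R[i]).

Lemma pi_related_equivalent b E p p' q q' : pi_related b p p' -> pi_related b q q' ->
  equivalent E p q -> equivalent E p' q'.
Proof.
move=> pp' qq' pq v w Evw.
have [+ _] := pi_rel_eq (pi_related_sqdist v w pp') (pi_related_sqdist v w qq').
by apply; exact: pq.
Qed.

(** The isomorphism is extended to the entries of the orthogonal matrix and of the translation,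
    whose defining equations are then transported. *)
Lemma pi_related_congruent b p p' q q' : pi_related b p p' -> pi_related b q q' ->
  congruent p q -> congruent p' q'.
Proof.
move=> pp' qq' [A [c [AtA [AAt qE]]]].
have [b1 bb1 [fA fAP]] := pi_extend (@uncountable_complex R) b
  (fun ij : 'I_d * 'I_d => A ij.1 ij.2).
have [b2 b1b2 [fc fcP]] := pi_extend (@uncountable_complex R) b1 (c 0).
pose A' : 'M[R[i]]_d := \matrix_(i, j) fA (i, j); pose c' : 'rV[R[i]]_d := \row_j fc j.
have AA' : pi_relmx b2 A A'.
  by move=> i j; rewrite [A' _ _]mxE; apply: b1b2; exact: (fAP (i, j)).
have cc' : pi_relmx b2 c c'.
  by move=> i j; rewrite [c' _ _]mxE (ord1 i); exact: fcP.
have AtA' := pi_relmx_tr AA'; have id1 := @pi_relmx1 _ b2 d.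
have rowP (x x' : realisation R V d) : pi_related b x x' -> forall v, pi_relmx b2 (x v) (x' v).
  by move=> xx' v i j; rewrite (ord1 i); exact/b1b2/bb1/xx'.
exists A', c'; split; [|split].
- exact: (pi_relmx_eq (pi_relmx_mul AtA' AA') id1 AtA).
- exact: (pi_relmx_eq (pi_relmx_mul AA' AtA') id1 AAt).
- move=> v; have pAc := pi_relmx_add (pi_relmx_mul (rowP _ _ pp' v) AtA') cc'.
  exact: (pi_relmx_eq (rowP _ _ qq' v) pAc (qE v)).
Qed.

Lemma pi_related_swap b p q : pi_related b p q -> pi_related (pi_swap b) q p.
Proof. by move=> pq v k; exact/pi_rel_swap. Qed.

(** Evaluation at either generic point has zero kernel, which gives an isomorphism from the
    coordinates of [p] to those of [p']. Representatives are carried forth by an extension; a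
    realisation equivalent to [p'] is carried back to find its class. *)
Lemma num_congruence_classes_generic E p p' n : generic p -> generic p' ->
  num_congruence_classes E p n -> num_congruence_classes E p' n.
Proof.
move=> genp genp' [r [pr r_inj r_surj]].
have eq0 P : ev p P = 0 <-> ev p' P = 0.
  by split=> [/(generic_eq0 genp)|/(generic_eq0 genp')] ->; exact: rmorph0.
pose b0 : partial_iso R[i] := PartialIso (mpoly_injective_nat _) eq0.
have pp' : pi_related b0 p p'.
  by move=> v k; exists (coordX v k); exact: ev_coordX.
have [b b0b [r' rr']] := pi_extend_realisations b0 r.
have {}pp' := pi_related_le b0b pp'.
exists r'; split.
- by move=> j; exact: (pi_related_equivalent pp' (rr' j) (pr j)).
- move=> j k jk; apply: r_inj.
  exact: (pi_related_congruent (pi_related_swap (rr' j)) (pi_related_swap (rr' k)) jk).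
- move=> q' p'q'; have [b1 bb1 [q q'q]] := pi_extend_realisation (pi_swap b) q'.
  have swap_le (x x' : realisation R V d) : pi_related b x x' -> pi_related b1 x' x.
    by move=> xx'; exact: (pi_related_le bb1 (pi_related_swap xx')).
  have [|j rq] := r_surj q.
    exact: (pi_related_equivalent (swap_le _ _ pp') q'q p'q').
  exists j; apply: (pi_related_congruent _ (pi_related_swap q'q) rq).
  exact/pi_related_swap/swap_le.
Qed.

Lemma equivalent_trans E p q r : equivalent E p q -> equivalent E q r -> equivalent E p r.
Proof. by move=> pq qr v w Evw; rewrite pq // qr. Qed.

Lemma equivalent_sym E p q : equivalent E p q -> equivalent E q p.
Proof. by move=> pq v w Evw; rewrite pq. Qed.

Lemma congruent_equivalent E p q : congruent p q -> equivalent E p q.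
Proof. by move=> pq v w _; exact: congruent_sqdist. Qed.

Lemma num_congruence_classes_equivalent E p q n : equivalent E p q ->
  num_congruence_classes E p n -> num_congruence_classes E q n.
Proof.
move=> pq [r [pr r_inj r_surj]]; exists r; split=> //.
- by move=> j; apply: equivalent_trans (pr j); exact: equivalent_sym.
- by move=> r' qr'; apply: r_surj; exact: equivalent_trans qr'.
Qed.

Lemma d_rigid_realisation_number E : (d < #|V|)%N -> d_rigid R d E ->
  exists n, realisation_number R d E n.
Proof.
move=> ltdV [p [genp rigp]].
have [n np] := exists_num_congruence_classes ltdV genp rigp.
by exists n => q genq; exact: num_congruence_classes_generic np.
Qed.

Lemma realisation_number_dvd (EG EH : rel V) cG cH : (d < #|V|)%N ->
    subrel EH EG -> d_rigid R d EH ->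
    realisation_number R d EG cG -> realisation_number R d EH cH ->
  (cG %| cH)%N.
Proof.
move=> ltdV HG [p [genp /rigid_algebraic algp]] numG numH.
have subGH (x y : realisation R V d) : equivalent EG x y -> equivalent EH x y.
  by move=> xy v w /HG; exact: xy.
have [r [pr r_inj r_surj]] := numH p genp.
pose eqG : rel 'I_cH := fun j k => `[< equivalent EG (r j) (r k) >].
(* The blocks of this relation on the indices of [r] are shown to have [cG] elements each. *)
have eqG_equiv : {in [set: 'I_cH]%SET & &, equivalence_rel eqG}.
  move=> i j k _ _ _; split; first by apply/asboolP.
  move=> /asboolP ij; apply/asboolP/asboolP; last exact: equivalent_trans.
  by apply: equivalent_trans; exact: equivalent_sym.
have parP := equivalence_partitionP eqG_equiv.
have := @card_uniform_partition _ cG _ _ _ parP; rewrite cardsT card_ord => -> //.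
  exact: dvdn_mull.
move=> _ /imsetP[j _ ->].
(* The number [cG] is known only for generic realisations; it reaches [r j] through a generic one
   congruent to it. *)
have [q genq qj] := equivalent_congruent_generic ltdV genp algp (pr j).
have [t [jt t_inj t_surj]] := num_congruence_classes_equivalent
  (@congruent_equivalent EG _ _ qj) (numG q genq).
(* Each class [G]-equivalent to [r j] is also [H]-equivalent to [p], hence listed by [r]; the block
   of [j] is the image of [h]. *)
have /choice[h hP] (k : 'I_cG) : exists l, congruent (r l) (t k).
  by apply: r_surj; exact: equivalent_trans (pr j) (subGH _ _ (jt k)).
have h_inj : injective h.
  move=> k l kl; apply: t_inj; apply: congruent_trans (hP l).
  by rewrite -kl; exact: congruent_sym.
rewrite -[RHS](card_ord cG) -(card_imset _ h_inj); congr #|pred_of_set _|.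
apply/setP => l; rewrite !inE /=; apply/asboolP/imsetP => [jl|[k _ ->]].
  have [k tkl] := t_surj _ jl; exists k => //; apply: r_inj.
  exact/congruent_sym/(congruent_trans (hP k)).
apply: (equivalent_trans (jt k)); apply/equivalent_sym/congruent_equivalent.
exact: hP.
Qed.
End Transfer.

Theorem theorem1p1 (R : realType) (V : finType) (d : nat) (EG EH : rel V) :
  (1 <= d)%N ->
  simple_graph EG -> simple_graph EH ->
  (d.+1 <= #|V|)%N ->
  d_rigid R d EG ->
  subrel EH EG ->
  d_rigid R d EH ->
  exists cG cH : nat,
    [/\ realisation_number R d EG cG,
        realisation_number R d EH cH
      & (cG %| cH)%N].
Proof.
move=> _ _ _ ltdV rigG HG rigH.
have [cG numG] := d_rigid_realisation_number ltdV rigG.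
have [cH numH] := d_rigid_realisation_number ltdV rigH.
exists cG, cH; split=> //; exact: realisation_number_dvd rigH numG numH.
Qed.
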